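(* Let $A\in\mathbf{R}^{n\times n}$ be symmetric with eigen-pairs $(\lambda_i,v_i)$, $i=1,\dots,n$, where $\lambda_n\le\cdots\le\lambda_1$ and $|\lambda_n|\le|\lambda_1|$, let $b\in\mathbf{R}^n$, and let $f(x)=\tfrac12 x^TAx-b^Tx$. Let $\alpha,\beta\ge 0$ be fixed and let $\hat H:=(1+\beta)I-\alpha A$. Given an initial point $x^{(0)}\in\mathbf{R}^n$, with $x^{(-1)}=x^{(0)}$, let $(x^{(k)})$ be the iterates of Gradient Descent with Momentum applied to $f$ with step size $\alpha$ and momentum parameter $\beta$, and let $g^{(k)}$ denote the gradient of $f$ at $x^{(k)}$. Then at any iteration $k\ge 0$, $$g^{(k+1)}=\hat H g^{(k)}-\beta g^{(k-1)}.$$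
   Context: The gradient of $f$ is $g(x)=Ax-b$, and $g^{(k)}:=g(x^{(k)})=Ax^{(k)}-b$ for all $k\ge -1$. Gradient Descent with Momentum (fixed step size $\alpha$, fixed momentum parameter $\beta$) is the iteration, for $k\ge 0$, $$x^{(k+1)}=x^{(k)}-\alpha g^{(k)}+\beta\,(x^{(k)}-x^{(k-1)}),$$ started from $x^{(-1)}=x^{(0)}$. $I$ is the $n\times n$ identity matrix. *)

(* Defs.v *)
From mathcomp Require Import all_boot all_order all_algebra.
From mathcomp Require Import all_classical all_reals all_analysis.

Set Implicit Arguments.
Unset Strict Implicit.
Unset Printing Implicit Defensive.
Import Order.TTheory GRing.Theory Num.Theory.
Import numFieldNormedType.Exports.
Local Open Scope ring_scope.

(* Vectors of R^n are columns. *)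

Definition gradient (R : realType) (n : nat) (f : 'cV[R]_n -> R) (x : 'cV[R]_n)
  : 'cV[R]_n :=
  \col_(i < n) 'D_(delta_mx i 0) f x.

(* The 1 x 1 matrices x^T A x and b^T x are read as scalars by taking their
   unique entry. *)
Definition quadratic (R : realType) (n : nat) (A : 'M[R]_n) (b : 'cV[R]_n)
    (x : 'cV[R]_n) : R :=
  2^-1 * (x^T *m A *m x) 0 0 - (b^T *m x) 0 0.

(* The [lam i] are all the eigenvalues of [A], repeated according to their
   multiplicity, and [v i] is an eigenvector for [lam i]. *)
Definition eigenpairs (R : realType) (n : nat) (A : 'M[R]_n)
    (lam : 'I_n -> R) (v : 'I_n -> 'cV[R]_n) : Prop :=
  char_poly A = \prod_(i < n) ('X - (lam i)%:P) /\
  forall i : 'I_n, v i != 0 /\ A *m v i = lam i *: v i.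

(* Iterates are indexed by [int] to allow for the index -1; the values of [x]
   at indices below -1 are irrelevant. *)
Definition gdm_iterates (R : realType) (n : nat) (f : 'cV[R]_n -> R)
    (alpha beta : R) (x0 : 'cV[R]_n) (x : int -> 'cV[R]_n) : Prop :=
  [/\ x 0 = x0, x (-1) = x0
    & forall k : int, 0 <= k ->
        x (k + 1) = x k - alpha *: gradient f (x k) + beta *: (x k - x (k - 1))].

(* Main.v *)
Require Import Defs.
From mathcomp Require Import all_boot all_order all_algebra.
From mathcomp Require Import all_classical all_reals all_analysis.
From mathcomp Require Import ring.
Import Order.TTheory GRing.Theory Num.Theory.
Import numFieldNormedType.Exports.
Local Open Scope ring_scope.

(** Since A is symmetric, the gradient of the quadratic is the affine map
    x |-> A x - b ([gradient_quadratic]): along any direction v the increment of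
    the quadratic at a is a polynomial of degree two in the step h, whose linear
    coefficient is v^T (A a - b) ([quadratic_shift]), so this coefficient is the
    directional derivative. Applying this affine map to the momentum update
    x' = x - alpha g(x) + beta (x - y) turns the displacements
    - alpha g(x) and beta (x - y) into - alpha A g(x) and beta (g(x) - g(y)),
    and collecting terms gives the recurrence. *)

(** The symmetry of A enters here: it identifies the two cross terms
    a^T A v and v^T A a, which together cancel the factor 1/2. *)
Lemma quadratic_shift (R : realType) (n : nat) (A : 'M[R]_n) (b a v : 'cV[R]_n)
    (h : R) : A^T = A ->
  quadratic A b (h *: v + a) - quadratic A b a =
  h * ((v^T *m (A *m a - b)) 0 0 + h * (2^-1 * (v^T *m A *m v) 0 0)).
Proof.
move=> A_sym.
have tr11 (M : 'M[R]_1) : M 0 0 = M^T 0 0 by rewrite mxE.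
have cross : (a^T *m A *m v) 0 0 = (v^T *m A *m a) 0 0.
  by rewrite tr11 !trmx_mul trmxK A_sym mulmxA.
have linear : (b^T *m v) 0 0 = (v^T *m b) 0 0.
  by rewrite tr11 trmx_mul trmxK.
have trv : (h *: v + a)^T = h *: v^T + a^T by rewrite linearD linearZ.
rewrite /quadratic trv !(mulmxDl, mulmxDr, mulmxN, mulmxA).
rewrite -!(scalemxAl, scalemxAr).
have entryD (M N : 'M[R]_1) : (M + N) 0 0 = M 0 0 + N 0 0 by rewrite mxE.
have entryN (M : 'M[R]_1) : (- M) 0 0 = - M 0 0 by rewrite mxE.
have entryZ c (M : 'M[R]_1) : (c *: M) 0 0 = c * M 0 0 by rewrite mxE.
rewrite !(entryD, entryN, entryZ) cross linear.
by field.
Qed.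

Lemma derive_quadratic (R : realType) (n : nat) (A : 'M[R]_n.+1)
    (b a v : 'cV[R]_n.+1) : A^T = A ->
  'D_v (quadratic A b) a = (v^T *m (A *m a - b)) 0 0.
Proof.
move=> A_sym; set c := (_ *m _) 0 0; set d := 2^-1 * (v^T *m A *m v) 0 0.
apply: cvg_lim => //.
have lim_affine : ((fun h : R => c + h * d) @ 0^' --> c + 0 * d)%classic.
  apply: cvgD; first exact: cvg_cst.
  by apply: cvgMl; apply: cvg_within_filter; exact: cvg_id.
rewrite mul0r addr0 in lim_affine.
apply: cvg_trans lim_affine; apply: near_eq_cvg.
near=> h.
have h_neq0 : h != 0 by near: h; exact: nbhs_dnbhs_neq.
by rewrite /= quadratic_shift // -/c -/d [_ *: _]mulKf.
Unshelve. all: by end_near.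
Qed.

Lemma gradient_quadratic (R : realType) (n : nat) (A : 'M[R]_n.+1)
    (b x : 'cV[R]_n.+1) : A^T = A -> gradient (quadratic A b) x = A *m x - b.
Proof.
move=> A_sym; apply/colP => i.
by rewrite mxE derive_quadratic // trmx_delta -rowE mxE.
Qed.

Theorem lemma2 (R : realType) (n : nat)
  (A : 'M[R]_n.+1) (lam : 'I_n.+1 -> R) (v : 'I_n.+1 -> 'cV[R]_n.+1)
  (A_sym : A^T = A)
  (A_eig : eigenpairs A lam v)
  (lam_sorted : forall i j : 'I_n.+1, (i <= j)%N -> lam j <= lam i)
  (lam_abs : `|lam ord_max| <= `|lam ord0|)
  (b : 'cV[R]_n.+1) (alpha beta : R)
  (alpha_ge0 : 0 <= alpha) (beta_ge0 : 0 <= beta)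
  (x0 : 'cV[R]_n.+1) (x : int -> 'cV[R]_n.+1)
  (x_gdm : gdm_iterates (quadratic A b) alpha beta x0 x) :
  let H := (1 + beta)%:M - alpha *: A in
  let g := fun k : int => gradient (quadratic A b) (x k) in
  forall k : int, 0 <= k -> g (k + 1) = H *m g k - beta *: g (k - 1).
Proof.
move=> H g k k_ge0; case: x_gdm => _ _ /(_ k k_ge0) x_step.
have gE j : g j = A *m x j - b by exact: gradient_quadratic.
have x_next : x (k + 1) = x k - alpha *: g k + beta *: (x k - x (k - 1)).
  exact: x_step.
have g_diff : A *m (x k - x (k - 1)) = g k - g (k - 1).
  by rewrite !gE mulmxBr opprB addrA subrK.
rewrite [LHS]gE x_next mulmxDr mulmxBr -!scalemxAr g_diff.
rewrite mulmxBl mul_scalar_mx -scalemxAl scalerDl scale1r scalerBr.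
have -> : A *m x k = g k + b by rewrite gE subrK.
by apply/colP => i; rewrite !mxE; ring.
Qed.
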